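(* Let $\mu=(\mu_j)_{j\ge1}$ be a quasianalytic admissible weight with $\mu_j\ge j$ for $j\ge1$ that satisfies the regularity conditions (i)--(iii) listed in the context. Let $M_0\ge1$ and $b_0\in(0,M_0)$. Let $L\subseteq\mathbb R^n$ be a convex body and $K\in\mathscr K(\mathbb R^n)$ with $K\subseteq\operatorname{int}(L)$, and assume $K$ is $(c_K,\theta_K)$-thick. Let $\mathbf N=\mathbf N(\mu,M_0,a_K,b_0)$ and let $f:L\to\mathbb R$ be a $(\mu^{|\infty},M_0)$-smooth function with $\|f\|_K\ge b_0$. Assume that $(\operatorname{grad}f|_K)^{-1}(0)\subseteq f|_K^{-1}(0)$. Then there is a neighborhood $U$ of $f|_K^{-1}(0)$ in $K$ and, for each $x\in U$, a neighborhood $B_x$ of $x$ in $L$ such that $$\|\operatorname{grad}f\|_{B_x}\ge\frac12\Big(\frac{2\|f\|_K}{3\mathbf C_{\mathbf N}}\Big)^{\frac1{\theta_K\mathbf N}}\Big(\frac{c_K\,\nu_K}{|K|}\Big)^{\frac1{\theta_K}}|f(x)|^{1-\frac1{\theta_K\mathbf N}},\qquad x\in U,$$ and $B_x$ shrinks to $x$ as $x$ tends to $f|_K^{-1}(0)$, i.e. $\operatorname{diam}(B_x)\to0$ as $x\in U\setminus f|_K^{-1}(0)$ tends to $f|_K^{-1}(0)$.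
   Context: $|E|$ denotes Lebesgue measure; $\|\operatorname{grad}f\|_B:=\sup_{y\in B}\sum_{i=1}^n|\partial_if(y)|$. A convex body is a compact convex set with nonempty interior. A nonempty measurable set $K\subseteq\mathbb R^n$ is $(c_K,\theta_K)$-thick, where $c_K,\theta_K>0$, if $|K\cap B(x,r)|\ge c_K r^{\theta_K}$ for all $x\in K$ and $0<r\le1$. Weights and smoothness. An admissible weight is a sequence $\mu=(\mu_j)_{j\ge1}$ of reals with $0<\mu_1\le\mu_2\le\cdots$; it is quasianalytic if $\sum_j1/\mu_j=\infty$. Regularity conditions: with $a_j:=(\mu_1\cdots\mu_j/j!)^{1/j}$, (i) $\liminf_{j\to\infty}a_j>0$; (ii) there is $H\ge1$ with $a_j\le Ha_k$ whenever $j\le k$; (iii) there is $C\ge1$ with $\mu_{j+1}\le C^j$ for $j\ge1$. Given $M_0>0$ put $M_j=M_0\mu_1\cdots\mu_j$, $j\ge1$. For $N\in\mathbb N_{\ge1}\cup\{\infty\}$ and nonempty compact $L\subseteq\mathbb R^n$, a map $f=(f_1,\dots,f_m):L\to\mathbb R^m$ is $(\mu^{|N},M_0)$-smooth if it is of class $C^N$ in some open neighborhood of $L$ and $\sup_{x\in L}\sum_{i=1}^m\sum_{|\alpha|=j}\frac{j!}{\alpha!}|\partial^\alpha f_i(x)|\le M_j$ for all integers $0\le j<N+1$. Also $\|f\|_E:=\sup_{x\in E}\sum_{i=1}^m|f_i(x)|$. Degree. For $A,a,b>0$ let $j_0$ be the smallest nonnegative integer $\ge\log(A/b)$. The tuple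 $(\mu,A,a,b)$ is admissible if $\sum_{j=j_0+1}^\infty 1/\mu_j>a\,e$ (automatic if $\mu$ is quasianalytic); then $\mathbf N(\mu,A,a,b):=2\sup\{k\in\mathbb N:\sum_{j=j_0+1}^k\frac1{a\mu_j}<e\}$ (empty sums are $0$). The constant $\mathbf C_{\mathbf N}$. Fix an increasing continuous, (piecewise) $C^1$ function $\tilde\mu:[1,\infty)\to(0,\infty)$ with $\tilde\mu(j)=\mu_j$ for integers $j\ge1$ (left derivatives are used at points of nondifferentiability), put $\gamma_{\tilde\mu}(k):=\sup_{1\le s\le k}\frac{s\tilde\mu'(s)}{\tilde\mu(s)}$, and $\mathbf C_{\mathbf N}:=(4e^{4+\gamma_{\tilde\mu}(\mathbf N)})^{\mathbf N}$. Admissible sets. A family $(K_w,a_w,\Upsilon_w)_{w\in W}$, where $W$ is any set, $K_w\subseteq[0,1]^n$ is compact, $a_w\in K_w$, and $\Upsilon_w:[0,\infty)^n\to\mathbb R^n$ is a map, is an admissible collection of degree $d\in\mathbb N_{\ge1}$ if there are constants $\delta_1,\delta_2,\delta_3>0$, $q\in\mathbb N_{\ge1}$ and polynomial maps $R_w:\mathbb R^n\to\mathbb R^n$ of degree at most $d$ such that for all $w\in W$: (1) $K_w$ is star-shaped with respect to $a_w$ and $|K_w|\ge\delta_1$; (2) $\Upsilon_w(x_1,\dots,x_n)=R_w(x_1^{1/q},\dots,x_n^{1/q})$; (3) $\delta_2\le\sum_\kappa|c_{w,\kappa}|\le\delta_3$, where $c_{w,\kappa}$ are the coefficients of the polynomial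 $\operatorname{Jac}(R_w)$ (the Jacobian determinant); (4) writing $a_w=(a_{w,1},\dots,a_{w,n})$, $a_{w,i}=0$ whenever $\Upsilon_w$ is not a polynomial map with respect to the variable $x_i$. A nonempty compact set $K\subseteq\mathbb R^n$ is admissible (of degree $d$) if there is an admissible collection (of degree $d$) $(K_w,a_w,\Upsilon_w)_{w\in K}$ indexed by $K$ with $\Upsilon_w(a_w)=w$ for each $w\in K$ and $K=\bigcup_{w\in K}\Upsilon_w(K_w)$. $\mathscr K(\mathbb R^n)$ is the family of all admissible sets. For each $K\in\mathscr K(\mathbb R^n)$ such a collection and its degree $d$ are fixed ($d=1$ if $K$ is a convex body), and $$a_K:=4\,\tfrac{(d+1)^{d+1}}{(d-1)^{d-1}}\max\{\operatorname{diam}(K),1\}\ \text{ if }d\ge2,\qquad a_K:=\operatorname{diam}(K)\ \text{ if }d=1.$$ The constant $\nu_K$. For $K\in\mathscr K(\mathbb R^n)$, $\nu_K\in(0,1]$ denotes a fixed constant depending only on $K$ (with $\nu_K=1/n$ if $K$ is a convex body) for which the paper's Remez inequality holds: for every convex body $L\supseteq K$, every admissible weight $\mu$ with $\mu_j\ge j$, all $M_0>b_0>0$ and $m\ge1$ with $(\mu,mM_0,a_K,b_0)$ admissible and $\mathbf N'=\mathbf N(\mu,mM_0,a_K,b_0)$, every $(\mu^{|\mathbf N'},M_0)$-smooth $f:L\to\mathbb R^m$ with $\|f\|_K\ge b_0$, and every measurable $E\subseteq K$ with $|E|>0$, $\|f\|_K\le\mathbf C_{\mathbf N'}\big(\frac{m|K|^{\nu_K}}{|K|^{\nu_K}-(|K|-|E|)^{\nu_K}}\big)^{\mathbf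 N'}\|f\|_E$. (Such a constant exists for every $K\in\mathscr K(\mathbb R^n)$.) *)

(* Defs.v *)
From HB Require Import structures.
From mathcomp Require Import all_boot all_order all_algebra.
(* The notations of mpoly are incompatible with those of MathComp-Analysis. *)
From mathcomp Require Import -(notations) mpoly.
From mathcomp Require Import all_classical all_reals all_analysis.

Set Implicit Arguments.
Unset Strict Implicit.
Unset Printing Implicit Defensive.

Import Order.TTheory GRing.Theory Num.Theory.
Import numFieldNormedType.Exports.

Local Open Scope classical_set_scope.
Local Open Scope ring_scope.

(* The points of R^n are the row vectors 'rV[R]_n.  Their library norm is the
   sup norm: it is used for topological notions only (on which it agrees with
   the Euclidean norm); lengths, balls and diameters are Euclidean. *)
Section EuclideanSpace.
Context {R : realType} {n : nat}.
Implicit Types (x y : 'rV[R]_n) (A K L : set 'rV[R]_n).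

Definition enorm x : R := Num.sqrt (\sum_i x 0 i ^+ 2).

Definition eball x (r : R) : set 'rV[R]_n := [set y | enorm (y - x) < r].

Definition diam A : R := sup [set enorm (p.1 - p.2) | p in A `*` A].

Definition convex_body L : Prop :=
  [/\ compact L, convex_set (L : set (convex_lmodType 'rV[R]_n)) & L° !=set0].

Definition star_shaped x A : Prop :=
  A x /\ forall y t, A y -> 0 <= t <= 1 -> A ((1 - t) *: x + t *: y).

Definition box x y : set 'rV[R]_n := [set z | forall i, x 0 i <= z 0 i <= y 0 i].

(* Lebesgue outer measure: infimum of the total volumes of the countable
   covers by compact boxes.  It is the Lebesgue measure on the sets that are
   measurable in the sense of Caratheodory. *)
Definition leb A : \bar R :=
  ereal_inf [set v | exists a b : nat -> 'rV[R]_n,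
    [/\ forall k i, a k 0 i <= b k 0 i,
        A `<=` \bigcup_k box (a k) (b k) &
        v = (\sum_(0 <= k <oo) (\prod_i (b k 0 i - a k 0 i))%:E)%E]].

Definition leb_measurable A : Prop := caratheodory_measurable leb A.

(* Real-valued measure, meaningful for sets of finite measure. *)
Definition vol A : R := fine (leb A).

Definition thick (c theta : R) K : Prop :=
  [/\ 0 < c, 0 < theta, K !=set0, leb_measurable K &
      forall x r, K x -> 0 < r <= 1 ->
        ((c * r `^ theta)%:E <= leb (K `&` eball x r))%E].

End EuclideanSpace.

(* Weights are functions on nat of which only the values at j >= 1 matter. *)
Section Weights.
Context {R : realType}.
Implicit Types (mu : nat -> R) (f : R -> R).

Definition admissible_weight mu : Prop :=
  0 < mu 1%N /\ forall j, (1 <= j)%N -> mu j <= mu j.+1.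

Definition quasianalytic mu : Prop :=
  (\sum_(1 <= j <oo) ((mu j)^-1)%:E = +oo)%E.

Definition wroot mu (j : nat) : R :=
  ((\prod_(1 <= i < j.+1) mu i) / j`!%:R) `^ (j%:R^-1).

Definition regular_weight mu : Prop :=
  [/\ (0 < limn_einf (fun j => (wroot mu j)%:E))%E,
      exists2 H, 1 <= H &
        forall j k, (1 <= j)%N -> (j <= k)%N -> wroot mu j <= H * wroot mu k &
      exists2 C, 1 <= C & forall j, (1 <= j)%N -> mu j.+1 <= C ^+ j].

Definition Mseq mu (M0 : R) (j : nat) : R := M0 * \prod_(1 <= i < j.+1) mu i.

(* The smallest natural number >= log (A / b). *)
Definition j0 (A b : R) : nat := `|Num.ceil (Num.max 0 (ln (A / b)))%R|%N.

Definition admissible_tuple mu (A a b : R) : Prop :=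
  ((a * expR 1)%:E < \sum_((j0 A b).+1 <= j <oo) ((mu j)^-1)%:E)%E.

(* For an admissible tuple the set below is nonempty and bounded, so that
   supremum returns its greatest element. *)
Definition degreeN mu (A a b : R) : nat :=
  (2 * supremum 0
    [set k | (\sum_((j0 A b).+1 <= j < k.+1) (a * mu j)^-1 < expR 1)%R])%N.

Definition piecewise_C1 f : Prop :=
  exists t : nat -> R,
    [/\ t 0%N = 1, forall k, t k < t k.+1, t @ \oo --> +oo &
        forall k, exists g : R -> R,
          [/\ forall x, derivable g x 1, continuous (derive1 g) &
              {in `[t k, t k.+1], f =1 g}]].

Definition interpolant mu f : Prop :=
  [/\ {in `[1, +oo[ &, {homo f : x y / x <= y}},
      {within `[1, +oo[, continuous f},
      piecewise_C1 f,
      forall s, 1 <= s -> 0 < f s &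
      forall j, (1 <= j)%N -> f j%:R = mu j].

(* The left derivative, which is the derivative wherever the latter exists;
   at the left endpoint 1 of the domain, the one-sided (right) derivative. *)
Definition lderive f (s : R) : R :=
  let q := fun h => h^-1 * (f (s + h) - f s) in
  if 1 < s then lim (q h @[h --> 0^'-]) else lim (q h @[h --> 0^'+]).

Definition gammaN f (k : R) : R :=
  sup [set s * lderive f s / f s | s in `[1, k]].

Definition CN f (N : nat) : R := (4 * expR (4 + gammaN f N%:R)) ^+ N.

End Weights.

(* A map L -> R^m that is smooth near L is represented by the family of its m
   components, extended to functions on R^n. *)
Section Smoothness.
Context {R : realType} {n : nat}.
Implicit Types (g : 'rV[R]_n -> R) (O L E : set 'rV[R]_n).

Definition partial (i : 'I_n) g : 'rV[R]_n -> R :=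
  fun x => 'D_(delta_mx 0 i : 'rV[R]_n) g x.

Definition partials (s : seq 'I_n) g : 'rV[R]_n -> R := foldr partial g s.

Definition mpartial (alpha : 'I_n -> nat) g : 'rV[R]_n -> R :=
  partials (flatten [seq nseq (alpha i) i | i <- enum 'I_n]) g.

(* Smoothness orders: [Some N] is the integer N and [None] is infinity. *)
Definition le_order (j : nat) (N : option nat) : bool :=
  if N is Some N' then (j <= N')%N else true.

Definition class_C (N : option nat) O g : Prop :=
  (forall s x, le_order (size s) N -> O x ->
     {for x, continuous (partials s g)}) /\
  (forall s i x, le_order (size s).+1 N -> O x ->
     derivable (partials s g) x (delta_mx 0 i)).

Definition smooth (mu : nat -> R) (N : option nat) (M0 : R) L m
    (f : 'I_m -> 'rV[R]_n -> R) : Prop :=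
  (exists O, [/\ open O, L `<=` O & forall i, class_C N O (f i)]) /\
  (forall j, le_order j N -> forall x, L x ->
     \sum_(i < m)
       \sum_(alpha : {ffun 'I_n -> 'I_j.+1} | (\sum_k alpha k)%N == j)
         j`!%:R / (\prod_k (alpha k)`!)%:R
           * `|mpartial (fun k => alpha k) (f i) x| <= Mseq mu M0 j).

Definition supnorm m (f : 'I_m -> 'rV[R]_n -> R) E : R :=
  sup [set \sum_i `|f i x| | x in E].

Definition grad g : 'I_n -> 'rV[R]_n -> R := fun i => partial i g.

End Smoothness.

Section AdmissibleSets.
Context {R : realType} {n : nat}.
Implicit Types (P : 'I_n -> mpoly n R) (K : set 'rV[R]_n).

Definition nonneg_orthant : set 'rV[R]_n := [set x | forall i, 0 <= x 0 i].

Definition polymap_eval P (x : 'rV[R]_n) : 'rV[R]_n :=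
  \row_j meval (x 0) (P j).

(* msize is the total degree plus one (and 0 for the zero polynomial). *)
Definition polymap_degree_le P (d : nat) : Prop :=
  forall j, (msize (P j) <= d.+1)%N.

Definition Jac P : mpoly n R :=
  \det (\matrix_(i, j) mderiv j (P i)).

Definition coef_sum (p : mpoly n R) : R :=
  \sum_(k <- msupp p) `|mcoeff k p|.

Definition polynomial_in (i : 'I_n) (Ups : 'rV[R]_n -> 'rV[R]_n) : Prop :=
  forall x, nonneg_orthant x -> exists p : 'I_n -> {poly R},
    forall t, 0 <= t -> forall j,
      Ups (\row_k (if k == i then t else x 0 k)) 0 j = (p j).[t].

Definition admissible_collection (T : Type) (W : set T) (d : nat)
    (Kw : T -> set 'rV[R]_n) (aw : T -> 'rV[R]_n)
    (Ups : T -> 'rV[R]_n -> 'rV[R]_n) : Prop :=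
  (1 <= d)%N /\
  (forall w, W w -> [/\ compact (Kw w),
     Kw w `<=` [set x | forall i, 0 <= x 0 i <= 1] & Kw w (aw w)]) /\
  exists (delta1 delta2 delta3 : R) (q : nat) (Rw : T -> 'I_n -> mpoly n R),
    [/\ 0 < delta1, 0 < delta2, 0 < delta3, (1 <= q)%N &
    forall w, W w ->
    [/\ polymap_degree_le (Rw w) d,
        star_shaped (aw w) (Kw w) /\ (delta1%:E <= leb (Kw w))%E,
        forall x, nonneg_orthant x ->
          Ups w x = polymap_eval (Rw w) (\row_i (x 0 i `^ q%:R^-1)),
        delta2 <= coef_sum (Jac (Rw w)) <= delta3 &
        forall i, ~ polynomial_in i (Ups w) -> aw w 0 i = 0]].

Definition admissible_set (d : nat) K : Prop :=
  [/\ compact K, K !=set0 &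
  exists (Kw : 'rV[R]_n -> set 'rV[R]_n) (aw : 'rV[R]_n -> 'rV[R]_n)
         (Ups : 'rV[R]_n -> 'rV[R]_n -> 'rV[R]_n),
    [/\ admissible_collection K d Kw aw Ups,
        forall w, K w -> Ups w (aw w) = w &
        K = \bigcup_(w in K) (Ups w @` Kw w)]].

Definition aK (d : nat) K : R :=
  if (2 <= d)%N then
    4 * ((d.+1)%:R ^+ d.+1 / (d.-1)%:R ^+ d.-1) * Num.max (diam K) 1
  else diam K.

(* [nu] is an admissible choice of nu_K: [d] is the degree of the collection
   fixed for [K], and [mut mu] is the interpolant fixed for the weight [mu]. *)
Definition remez_constant (mut : (nat -> R) -> R -> R) (d : nat) K (nu : R)
    : Prop :=
  [/\ 0 < nu <= 1,
      convex_body K -> nu = n%:R^-1 &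
  forall (L : set 'rV[R]_n) (mu : nat -> R) (M0 b0 : R) (m : nat),
    convex_body L -> K `<=` L ->
    admissible_weight mu -> (forall j, (1 <= j)%N -> j%:R <= mu j) ->
    0 < b0 -> b0 < M0 -> (1 <= m)%N ->
    admissible_tuple mu (m%:R * M0) (aK d K) b0 ->
    let N := degreeN mu (m%:R * M0) (aK d K) b0 in
    forall f : 'I_m -> 'rV[R]_n -> R,
    smooth mu (Some N) M0 L f -> b0 <= supnorm f K ->
    forall E : set 'rV[R]_n,
    E `<=` K -> leb_measurable E -> (0 < leb E)%E ->
    supnorm f K <=
      CN (mut mu) N *
      (m%:R * vol K `^ nu
         / (vol K `^ nu - (vol K - vol E) `^ nu)) ^+ N * supnorm f E].

End AdmissibleSets.

(* Main.v *)
(** Apply the Remez inequality to the part of [K] in the cube of radius [r]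
    around a point [x] of [K]: thickness bounds its volume below by
    [cK r^thetaK], and Bernoulli's inequality [(1 - t)^nu <= 1 - nu t] turns the
    Remez factor into a power of [r].  Hence [|f|] reaches the value
    [kappa r^(thetaK N)] in that cube, where
    [kappa = |f|_K / C_N * (cK nuK / |K|)^N].  When [r] is chosen so that this
    value is [3/2 |f x|], the function grows by [|f x| / 2] over a distance [r],
    and the mean value inequality bounds the gradient below by [|f x| / (2 r)].
    At the zeros of [f] the claim is void unless [thetaK N = 1], in which case
    [r = 1] and the neighborhood [L] do. *)
Require Import Defs.
From HB Require Import structures.
From mathcomp Require Import all_boot all_order all_algebra.
From mathcomp Require Import all_classical all_reals all_analysis.
From mathcomp Require Import ring lra.

Set Implicit Arguments.
Unset Strict Implicit.
Unset Printing Implicit Defensive.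

Import Order.TTheory GRing.Theory Num.Theory.
Import numFieldNormedType.Exports.

Local Open Scope classical_set_scope.
Local Open Scope ring_scope.

Section BoxMeasure.
Context {R : realType} {n : nat}.
Implicit Types (A B X : set 'rV[R]_n) (a b : nat -> 'rV[R]_n).

Lemma box_volume_ge0 (x y : 'rV[R]_n) :
  (forall i, x 0 i <= y 0 i) -> (0 <= (\prod_i (y 0 i - x 0 i))%:E)%E.
Proof. by move=> xy; rewrite lee_fin; apply: prodr_ge0 => i _; rewrite subr_ge0. Qed.

Lemma leb_ge0 A : (0 <= leb A)%E.
Proof.
apply: le_ereal_inf_tmp => _ [a [b [ab _ ->]]].
by apply: nneseries_ge0 => k _ _; exact: box_volume_ge0.
Qed.

Lemma le_leb A B : A `<=` B -> (leb A <= leb B)%E.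
Proof.
move=> AB; apply: le_ereal_inf => v [a [b [ab Bab ->]]].
by exists a, b; split=> //; exact: subset_trans Bab.
Qed.

Lemma leb_cover_adherent A (e : R) : 0 < e -> leb A \is a fin_num ->
  exists a b, [/\ forall k i, a k 0 i <= b k 0 i,
    A `<=` \bigcup_k box (a k) (b k) &
    (\sum_(0 <= k <oo) (\prod_i (b k 0 i - a k 0 i))%:E <= leb A + e%:E)%E].
Proof.
move=> e0 fA; have [v [a [b [ab Aab ->]]] /ltW v_lt] := lb_ereal_inf_adherent e0 fA.
by exists a, b; split.
Qed.

Lemma sum_interleave (u v : nat -> \bar R) m :
  (\sum_(0 <= k < m.*2) (if odd k then v k./2 else u k./2) =
   \sum_(0 <= k < m) u k + \sum_(0 <= k < m) v k)%E.
Proof.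
elim: m => [|m IH]; first by rewrite !big_geq// adde0.
rewrite doubleS !big_nat_recr//= IH odd_double/= uphalf_double half_double.
by rewrite -!addeA; congr (_ + _)%E; rewrite addeCA.
Qed.

Lemma nneseries_interleave_le (u v : nat -> \bar R) :
  (forall k, 0 <= u k)%E -> (forall k, 0 <= v k)%E ->
  (\sum_(0 <= k <oo) (if odd k then v k./2 else u k./2) <=
   \sum_(0 <= k <oo) u k + \sum_(0 <= k <oo) v k)%E.
Proof.
move=> u0 v0; apply: lime_le.
  by apply: is_cvg_nneseries => k _ _; case: ifP.
near=> m; apply: (@le_trans _ _
    (\sum_(0 <= k < m.*2) (if odd k then v k./2 else u k./2))%E).
  rewrite -addnn [leRHS](@big_cat_nat _ _ _ m)//= ?leq_addr//.
  by rewrite leeDl// sume_ge0// => k; case: ifP.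
by rewrite sum_interleave leeD// nneseries_lim_ge.
Unshelve. all: by end_near. Qed.

Lemma lebU_le A B : (leb (A `|` B) <= leb A + leb B)%E.
Proof.
have [->|fA] := eqVneq (leb A) +oo%E; first by rewrite addye ?leey// gt_eqF// (lt_le_trans _ (leb_ge0 _)).
have [->|fB] := eqVneq (leb B) +oo%E; first by rewrite addey ?leey// gt_eqF// (lt_le_trans _ (leb_ge0 _)).
have {}fA : leb A \is a fin_num by rewrite ge0_fin_numE ?leb_ge0// ltey.
have {}fB : leb B \is a fin_num by rewrite ge0_fin_numE ?leb_ge0// ltey.
apply/lee_addgt0Pr => e e0; have e20 : 0 < e / 2 by rewrite divr_gt0.
have [a [b [ab Aab lea]]] := leb_cover_adherent e20 fA.
have [a' [b' [ab' Bab' leb']]] := leb_cover_adherent e20 fB.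
have -> : (leb A + leb B + e%:E = (leb A + (e / 2)%:E) + (leb B + (e / 2)%:E))%E.
  by rewrite addeACA -EFinD -splitr.
apply: le_trans (leeD lea leb').
apply: le_trans (nneseries_interleave_le _ _).
- apply: ereal_inf_lbound.
  exists (fun k => if odd k then a' k./2 else a k./2),
         (fun k => if odd k then b' k./2 else b k./2); split.
  + by move=> k i; case: ifP.
  + move=> x [/Aab[k _ kx]|/Bab'[k _ kx]].
      by exists k.*2 => //; rewrite odd_double half_double.
    by exists k.*2.+1 => //=; rewrite odd_double uphalf_double.
  + by apply: eq_eseriesr => k _; case: ifP.
- by move=> k; exact: box_volume_ge0.
- by move=> k; exact: box_volume_ge0.
Qed.

Definition minmax_coord (op : R -> R -> R) (i : 'I_n) (c : R) (x : 'rV[R]_n) : 'rV[R]_n :=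
  \row_j (if j == i then op (x 0 j) c else x 0 j).

(* A cut by [y 0 i = c] splits every box of a cover into two boxes of the same
   total volume. *)
Lemma leb_measurable_halfspace (i : 'I_n) (c : R) (H : set 'rV[R]_n) :
  [set y : 'rV[R]_n | y 0 i < c] `<=` H -> H `<=` [set y : 'rV[R]_n | y 0 i <= c] -> leb_measurable H.
Proof.
move=> ltH Hle X; apply/eqP; rewrite eq_le; apply/andP; split.
  by rewrite -{1}[X](setIT) -(setUv H) setIUr lebU_le.
have [->|fX] := eqVneq (leb X) +oo%E; first by rewrite leey.
have {}fX : leb X \is a fin_num by rewrite ge0_fin_numE ?leb_ge0// ltey.
apply/lee_addgt0Pr => e e0; have [a [b [ab Xab lea]]] := leb_cover_adherent e0 fX.
apply: le_trans lea.
pose lo := minmax_coord Num.min i c; pose hi := minmax_coord Num.max i c.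
have lo_le k j : lo (a k) 0 j <= lo (b k) 0 j.
  by rewrite !mxE; case: eqP => // ->; rewrite le_min !ge_min lexx ab orbT.
have hi_le k j : hi (a k) 0 j <= hi (b k) 0 j.
  by rewrite !mxE; case: eqP => // ->; rewrite ge_max !le_max lexx ab orbT.
rewrite (_ : (\sum_(0 <= k <oo) _)%E =
  (\sum_(0 <= k <oo) (\prod_i (lo (b k) 0 i - lo (a k) 0 i))%:E +
   \sum_(0 <= k <oo) (\prod_i (hi (b k) 0 i - hi (a k) 0 i))%:E)%E); last first.
  rewrite -nneseriesD => [|k _ _|k _ _]; [|exact: box_volume_ge0|exact: box_volume_ge0].
  apply: eq_eseriesr => k _; rewrite -EFinD; congr (_%:E).
  have vol_op op : \prod_j (minmax_coord op i c (b k) 0 j - minmax_coord op i c (a k) 0 j) =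
      (op (b k 0 i) c - op (a k 0 i) c) * \prod_(j | j != i) (b k 0 j - a k 0 j).
    rewrite (bigD1 i)//= !mxE eqxx; congr (_ * _).
    by apply: eq_bigr => j ji; rewrite !mxE (negbTE ji).
  rewrite !vol_op (bigD1 i)//= -mulrDl; congr (_ * _).
  by rewrite addrACA addr_min_max -opprD addr_min_max; ring.
apply: leeD; apply: ereal_inf_lbound.
- exists (lo \o a), (lo \o b); split=> // x [/Xab[k _ kx] /Hle/= xc].
  exists k => // j; have /andP[ax xb] := kx j.
  rewrite !mxE; case: eqP => [ji|_]; last by rewrite ax.
  by rewrite ge_min ax/= le_min xb ji.
- exists (hi \o a), (hi \o b); split=> // x [/Xab[k _ kx] Hx].
  have xc : c <= x 0 i by rewrite leNgt; apply/negP => /ltH.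
  exists k => // j; have /andP[ax xb] := kx j.
  rewrite !mxE; case: eqP => [ji|_]; last by rewrite ax.
  by rewrite ge_max ax/= le_max xb ji xc.
Qed.

Lemma leb_le_box A (x y : 'rV[R]_n) : (0 < n)%N -> (forall i, x 0 i <= y 0 i) ->
  A `<=` box x y -> (leb A <= (\prod_i (y 0 i - x 0 i))%:E)%E.
Proof.
move=> n0 xy Axy; apply: ereal_inf_lbound.
exists (fun k => if k == 0%N then x else 0), (fun k => if k == 0%N then y else 0).
split; first by case=> [|k] i //=; rewrite mxE.
- by move=> z /Axy zxy; exists 0%N.
rewrite (nneseriesD1 (n := 0%N))//= => [|[|k] _]; try by apply: box_volume_ge0 => i; rewrite /= ?mxE.
rewrite eseries0 ?adde0// => -[//|k] _ _ /=.
by rewrite (bigD1 (Ordinal n0))//= mxE subrr mul0r.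
Qed.

Lemma leb_measurableC A : leb_measurable A -> leb_measurable (~` A).
Proof. by move=> mA X; rewrite setCK addeC -mA. Qed.

Lemma leb_measurableI A B :
  leb_measurable A -> leb_measurable B -> leb_measurable (A `&` B).
Proof.
move=> mA mB X; rewrite (mA X) (mB (X `&` A)) (mA (X `&` ~` (A `&` B))).
rewrite -addeA; congr (_ + _)%E; first by rewrite setIA.
congr (_ + _)%E; congr leb; apply/seteqP; split=> x /=.
- by move=> [[Xx Ax] nB]; split=> //; split=> // -[].
- by move=> [[Xx nAB] Ax]; split=> // Bx; exact: nAB.
- by move=> [Xx nA]; split=> //; split=> // -[].
- by move=> [[]].
Qed.

Lemma leb_measurable_box (x y : 'rV[R]_n) : (0 < n)%N -> leb_measurable (box x y).
Proof.
move=> n0; have mT : leb_measurable (setT : set 'rV[R]_n).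
  move=> X; rewrite setIT setCT setI0.
  apply/eqP; rewrite eq_le leeDl ?leb_ge0//=.
  suff -> : leb (set0 : set 'rV[R]_n) = 0%E by rewrite adde0.
  apply/eqP; rewrite eq_le leb_ge0 andbT.
  apply: le_trans (leb_le_box n0 (fun i => lexx ((0 : 'rV[R]_n) 0 i)) (@sub0set _ _)) _.
  by rewrite (bigD1 (Ordinal n0))//= subrr mul0r.
suff mS (s : seq 'I_n) : leb_measurable [set z : 'rV[R]_n | forall i, i \in s -> x 0 i <= z 0 i <= y 0 i].
  rewrite (_ : box x y = [set z : 'rV[R]_n | forall i, i \in enum 'I_n -> x 0 i <= z 0 i <= y 0 i]) //.
  apply/seteqP; split=> z /= xzy i; first by move=> _; exact: xzy.
  by apply: xzy; rewrite mem_enum.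
elim: s => [|i s IH].
  by rewrite (_ : [set _ | _] = setT)//; apply/seteqP; split.
rewrite (_ : [set _ | _] = ([set z : 'rV[R]_n | z 0 i <= y 0 i] `&` ~` [set z : 'rV[R]_n | z 0 i < x 0 i])
  `&` [set z : 'rV[R]_n | forall i, i \in s -> x 0 i <= z 0 i <= y 0 i]); last first.
  apply/seteqP; split=> z /=.
    move=> xzy; split; last by move=> j js; apply: xzy; rewrite inE js orbT.
    have /andP[xz zy] := xzy i (mem_head _ _).
    by split=> //; apply/negP; rewrite -leNgt.
  move=> [[zy /negP]]; rewrite -leNgt => xz xzy j.
  by rewrite inE => /orP[/eqP->|/xzy//]; rewrite xz.
apply: leb_measurableI => //; apply: leb_measurableI.
  by apply: (@leb_measurable_halfspace i (y 0 i)) => // z /= /ltW.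
apply: leb_measurableC.
by apply: (@leb_measurable_halfspace i (x 0 i)) => // z /= /ltW.
Qed.

End BoxMeasure.

Section C1Calculus.
Context {R : realType} {n : nat}.
Implicit Types (g : 'rV[R]_n -> R) (x y z p v : 'rV[R]_n).

Lemma is_derive_line g p v (s : R) : derivable g (p + s *: v) v ->
  is_derive s 1 (fun t : R => g (p + t *: v)) ('D_v g (p + s *: v)).
Proof.
move=> dg.
have E : (fun h : R => h^-1 *: ((g \o shift (p + s *: v)) (h *: v) - g (p + s *: v))) =
  (fun h : R => h^-1 *: (((fun t : R => g (p + t *: v)) \o shift s) (h *: 1) - g (p + s *: v))).
  apply/funext => h /=; congr (_ *: (g _ - _)).
  by rewrite [h *: 1]mulr1 scalerDl addrCA.
split; first by move: dg; rewrite /derivable E.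
by rewrite /derive E.
Qed.

Lemma mvt_affine (h dh : R -> R) (a b c e : R) :
  (forall s, Num.min a b <= s <= Num.max a b ->
     is_derive s 1 h (dh s) /\ `|dh s - c| <= e) ->
  `|h b - h a - c * (b - a)| <= e * `|b - a|.
Proof.
wlog ab : a b / a <= b.
  move=> W H; have [/W|/ltW ba] := leP a b; first exact.
  have := W _ _ ba; rewrite minC maxC => /(_ H).
  by rewrite (distrC a b) -(normrN (h a - _ - _)); congr (`|_| <= _); ring.
rewrite min_l// max_r// => H.
have D s : s \in `]a, b[ -> is_derive s 1 h (dh s).
  by rewrite in_itv/= => /andP[/ltW as_ /ltW sb]; apply: (H s _).1; rewrite as_.
have C : {within `[a, b], continuous h}.
  apply: derivable_within_continuous => s; rewrite in_itv/= => /H[[]].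
  by [].
have [s] := MVT_segment ab D C; rewrite in_itv/= => /H[_ le_e] ->.
by rewrite -mulrBl normrM ler_wpM2r.
Qed.

Lemma increment_estimate g z y (rho e : R) (c : 'I_n -> R) : ball z rho y ->
  (forall i w, ball z rho w ->
     derivable g w (delta_mx 0 i) /\ `|partial i g w - c i| <= e) ->
  `|g y - g z - \sum_i c i * (y 0 i - z 0 i)| <= e * \sum_i `|y 0 i - z 0 i|.
Proof.
move=> zy H.
pose p (k : nat) : 'rV[R]_n := \row_j (if (j < k)%N then y 0 j else z 0 j).
have p0 : p 0%N = z by apply/rowP => j; rewrite mxE.
have pn : p n = y by apply/rowP => j; rewrite mxE ltn_ord.
rewrite -{1}pn -{1}p0 -(telescope_sumr (g \o p))// big_mkord -sumrB mulr_sumr.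
apply: (le_trans (ler_norm_sum _ _ _)); apply: ler_sum => i _ /=.
pose q : 'rV[R]_n := p i - z 0 i *: delta_mx 0 i.
have qE s : q + s *: delta_mx 0 i = \row_j (if j == i then s else p i 0 j).
  apply/rowP => j; rewrite !mxE eqxx/=.
  have [->|_] := eqVneq j i; last by rewrite !mulr0 subr0 addr0.
  by rewrite ltnn !mulr1 subrr add0r.
have -> : p i = q + z 0 i *: delta_mx 0 i by rewrite subrK.
have -> : p i.+1 = q + y 0 i *: delta_mx 0 i.
  rewrite qE; apply/rowP => j; rewrite !mxE ltnS leq_eqVlt -val_eqE/=.
  by case: eqVneq => [/val_inj ->|].
apply: (@mvt_affine (fun s : R => g (q + s *: delta_mx 0 i))
  (fun s => partial i g (q + s *: delta_mx 0 i))) => s sI.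
suff /(H i)[dg le_e] : ball z rho (q + s *: delta_mx 0 i).
  by split; [exact: is_derive_line|exact: le_e].
case: zy => rho0 zy; split=> // i0 j; rewrite (ord1 i0) qE !mxE.
have [->|_] := eqVneq j i; last first.
  by case: ifP => // _; exact: ballxx.
apply: le_lt_trans (zy 0 i : `|_ - _| < _).
move: sI; case: (leP (z 0 i) (y 0 i)) => [zy_i|/ltW yz_i] /andP[zs sy].
  by rewrite ler0_norm ?subr_le0// ler0_norm ?subr_le0// !opprB lerD2r.
by rewrite ger0_norm ?subr_ge0// ger0_norm ?subr_ge0// lerD2l lerN2.
Qed.

Lemma is_derive_C1_line g O x v (t : R) : open O -> class_C None O g ->
  O (x + t *: v) ->
  is_derive t 1 (fun s : R => g (x + s *: v))
    (\sum_i partial i g (x + t *: v) * v 0 i).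
Proof.
move=> oO [gC gD] Ot; set z := x + t *: v; set c := fun i => partial i g z.
suff cvg : (fun h : R => h^-1 *: (((fun s : R => g (x + s *: v)) \o shift t) (h *: 1)
    - g (x + t *: v))) @ 0^' --> \sum_i c i * v 0 i.
  split; first by apply/cvg_ex; exists (\sum_i c i * v 0 i).
  by rewrite /derive; exact/cvg_lim.
apply/cvgrPdist_le => eps eps0.
pose S := \sum_i `|v 0 i|.
have S0 : 0 <= S by rewrite sumr_ge0.
have S1 : 0 < S + 1 by rewrite ltr_wpDl.
have e0 : 0 < eps / (S + 1) by rewrite divr_gt0.
have : \forall w \near z, forall i, derivable g w (delta_mx 0 i) /\
    `|partial i g w - c i| <= eps / (S + 1).
  apply: (@filter_forall _ _ _ _ (nbhs_filter z)) => i.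
  have Oz : \forall w \near z, O w by apply: open_nbhs_nbhs.
  have /cvgrPdist_le/(_ _ e0) := gC [:: i] z erefl Ot.
  apply: filterS2 Oz => w Ow; rewrite distrC; split=> //.
  exact: (gD [::]).
move=> /nbhs_ballP[rho /= rho0 H].
have : \forall h \near (0:R)^', ball z rho (z + h *: v).
  have cz : (fun h : R => z + h *: v) @ (0:R)^' --> z.
    rewrite -[X in _ --> X]addr0 -[X in _ + X](scale0r v).
    apply: cvgD; first exact: cvg_cst.
    by apply: cvgZr_tmp; exact/cvg_within.
  exact: (cvg_ball cz rho0).
have : \forall h \near (0:R)^', h != 0 by exact: nbhs_dnbhs_neq.
apply: filterS2 => h h0 zh.
have := increment_estimate zh (fun i w zw => H w zw i).
have -> : \sum_i c i * ((z + h *: v) 0 i - z 0 i) = h * \sum_i c i * v 0 i.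
  rewrite mulr_sumr; apply: eq_bigr => i _; rewrite !mxE addrC addKr.
  by rewrite mulrCA.
have -> : \sum_i `|(z + h *: v) 0 i - z 0 i| = `|h| * S.
  rewrite mulr_sumr; apply: eq_bigr => i _; rewrite !mxE addrC addKr.
  by rewrite normrM.
rewrite -/z /= [h *: 1]mulr1 => est.
have -> : x + (h + t) *: v = z + h *: v by rewrite scalerDl addrA addrAC.
rewrite distrC -(ler_pM2l (x := `|h|)) ?normr_gt0// -normrM mulrBr.
rewrite [_^-1 *: _]mulrC mulrCA divff// mulr1.
apply: le_trans est _; rewrite mulrCA ler_wpM2l//.
by rewrite mulrAC ler_pdivrMr// ler_wpM2l ?ltW// ltrDl.
Qed.

End C1Calculus.

Section MeanValue.
Context {R : realType} {n : nat}.
Implicit Types (g : 'rV[R]_n -> R) (x y : 'rV[R]_n) (O A E L : set 'rV[R]_n).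

Lemma mean_value_ineq g O x y (G rho : R) : open O -> class_C None O g ->
  (forall t, 0 <= t <= 1 -> O (x + t *: (y - x)) /\
     \sum_i `|grad g i (x + t *: (y - x))| <= G) ->
  (forall i, `|y 0 i - x 0 i| <= rho) -> 0 <= rho ->
  `|g y - g x| <= G * rho.
Proof.
move=> oO gO seg yx rho0.
have := @mvt_affine _ (fun t => g (x + t *: (y - x)))
  (fun t => \sum_i partial i g (x + t *: (y - x)) * (y - x) 0 i) 0 1 0 (G * rho).
rewrite scale1r scale0r addr0 subrKC mul0r !subr0 normr1 mulr1; apply => t.
rewrite min_l ?ler01// max_r ?ler01// => /seg[Ot tG]; split.
  exact: (is_derive_C1_line oO gO Ot).
rewrite subr0; apply: le_trans (ler_norm_sum _ _ _) _.
apply: le_trans (ler_wpM2r rho0 tG); rewrite mulr_suml; apply: ler_sum => i _.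
by rewrite normrM ler_wpM2l// !mxE.
Qed.

Lemma convex_segment L x y (t : R) :
  convex_set (L : set (convex_lmodType 'rV[R]_n)) -> L x -> L y ->
  0 <= t <= 1 -> L (x + t *: (y - x)).
Proof.
move=> cL Lx Ly /andP[t0 t1].
have := cL y x (Itv01 t0 t1) (mem_set Ly) (mem_set Lx); rewrite inE.
suff -> : conv (Itv01 t0 t1) (y : convex_lmodType 'rV[R]_n) x = x + t *: (y - x) by [].
rewrite /conv/= /unstable.onem scalerBl scale1r scalerBr addrC -addrA.
by congr (_ + _); rewrite addrC.
Qed.

Lemma supnorm_has_ub m (f : 'I_m -> 'rV[R]_n -> R) A E : compact A -> E `<=` A ->
  (forall i x, A x -> {for x, continuous (f i)}) ->
  has_ubound [set \sum_i `|f i x| | x in E].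
Proof.
move=> cA EA fA.
have bnd i : exists M, forall x, A x -> `|f i x| <= M.
  have [A0|nA0] := pselect (A !=set0); last first.
    by exists 0 => x Ax; exfalso; apply: nA0; exists x.
  have cont : {within A, continuous (fun x => `|f i x|)}.
    apply: continuous_in_subspaceT => x /set_mem Ax.
    by apply: (continuous_comp (fA i x Ax)); exact: norm_continuous.
  have [c _ cmax] := compact_EVT_max A0 cA cont.
  by exists `|f i c| => x Ax; apply: cmax; rewrite inE.
have [M fM] := choice bnd.
exists (\sum_i M i) => _ [x /EA Ax <-].
by apply: ler_sum => i _; exact: fM.
Qed.

Lemma le_supnorm m (f : 'I_m -> 'rV[R]_n -> R) A E x : compact A -> E `<=` A ->
  (forall i x, A x -> {for x, continuous (f i)}) ->
  E x -> \sum_i `|f i x| <= supnorm f E.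
Proof.
by move=> cA EA fA Ex; apply: ub_le_sup; [exact: supnorm_has_ub fA|exists x].
Qed.

Lemma supnorm_le m (f : 'I_m -> 'rV[R]_n -> R) E (G : R) : E !=set0 ->
  (forall x, E x -> \sum_i `|f i x| <= G) -> supnorm f E <= G.
Proof.
move=> [x Ex] fG; apply: ge_sup; first by exists (\sum_i `|f i x|), x.
by move=> _ [z Ez <-]; exact: fG.
Qed.

End MeanValue.

Section RealInequalities.
Context {R : realType}.
Implicit Types (a nu : R).

Lemma powR_bernoulli a nu : 0 <= a -> 0 < nu <= 1 -> a `^ nu <= 1 + nu * (a - 1).
Proof.
move=> a_ge0 /andP[nu0 nu1].
have [->|a_neq0] := eqVneq a 0.
  by rewrite powR0 ?gt_eqF// sub0r mulrN1 subr_ge0.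
have a0 : 0 < a by rewrite lt_neqAle eq_sym a_neq0.
have b0 : 0 < 1 + nu * (a - 1) by nra.
rewrite /powR (negbTE a_neq0) -[leRHS]lnK ?posrE// ler_expR.
have := concave_ln (Itv01 (ltW nu0) nu1) a0 ltr01.
rewrite !convRE/= ln1 mulr0 addr0 mulr1 /unstable.onem.
by rewrite (_ : nu * a + (1 - nu) = 1 + nu * (a - 1))//; ring.
Qed.

Lemma remez_ratio_le (V e nu : R) : 0 < e <= V -> 0 < nu <= 1 ->
  0 <= V `^ nu / (V `^ nu - (V - e) `^ nu) <= V / (nu * e).
Proof.
move=> /andP[e0 eV] /andP[nu0 nu1]; have V0 : 0 < V by exact: lt_le_trans eV.
have Vnu0 : 0 < V `^ nu by rewrite powR_gt0.
have a0 : 0 <= 1 - e / V by rewrite subr_ge0 ler_pdivrMr// mul1r.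
have key : nu * e / V <= 1 - (1 - e / V) `^ nu.
  have := powR_bernoulli a0 (introT andP (conj nu0 nu1)).
  rewrite (_ : 1 - e / V - 1 = - (e / V)); last by ring.
  by rewrite mulrN -mulrA => H; rewrite lerBrDr addrC -lerBrDr.
have neV0 : 0 < nu * e / V by rewrite divr_gt0// mulr_gt0.
have -> : V - e = V * (1 - e / V) by field; rewrite gt_eqF.
rewrite powRM ?(ltW V0)// -[X in _ / (X - _)]mulr1 -mulrBr invfM mulrA divff ?gt_eqF// mul1r.
have d0 : 0 < 1 - (1 - e / V) `^ nu by exact: lt_le_trans key.
rewrite invr_ge0 (ltW d0)/= -(invrK (V / (nu * e))) invf_div.
by rewrite lef_pV2 ?posrE.
Qed.

End RealInequalities.

Section Degree.
Context {R : realType}.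
Context (mu : nat -> R).
Context (mu_adm : admissible_weight mu) (mu_qa : quasianalytic mu).

Lemma admissible_weight_gt0 j : (1 <= j)%N -> 0 < mu j.
Proof.
case: mu_adm => mu1 mu_incr; elim: j => // -[//|j] IH _.
by apply: lt_le_trans (IH _) (mu_incr _ _).
Qed.

Lemma quasianalytic_tail m : (1 <= m)%N ->
  (\sum_(m <= j <oo) ((mu j)^-1)%:E = +oo)%E.
Proof.
move=> m1; have inv0 k : (1 <= k)%N -> (0 <= ((mu k)^-1)%:E)%E.
  by move=> k1; rewrite lee_fin invr_ge0 ltW// admissible_weight_gt0.
move: mu_qa; rewrite /quasianalytic (@nneseries_split _ _ 1 (m - 1))//.
rewrite subnKC// sumEFin.
have : (0 <= \sum_(m <= k <oo) ((mu k)^-1)%:E)%E.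
  by apply: nneseries_ge0 => k mk _; apply: inv0; exact: leq_trans mk.
by case: (\sum_(m <= k <oo) ((mu k)^-1)%:E)%E.
Qed.

Lemma quasianalytic_admissible (A a b : R) : admissible_tuple mu A a b.
Proof. by rewrite /admissible_tuple quasianalytic_tail// ltry. Qed.

Lemma degreeN_gt0 (A a b : R) : 0 < a -> 0 < b < A -> (0 < degreeN mu A a b)%N.
Proof.
move=> a0 /andP[b0 bA]; rewrite /degreeN muln_gt0/=.
set S := [set k | _].
have j0_gt0 : (0 < j0 A b)%N.
  rewrite /j0 absz_gt0 gt_eqF//.
  rewrite ceil_gt0 lt_max; apply/orP; right.
  by rewrite ln_gt0// ltr_pdivlMr// mul1r.
have Sj0 : S (j0 A b) by rewrite /S/= big_geq// expR_gt0.
apply: (leq_trans j0_gt0); rewrite -leEnat; apply: ge_supremum_Nmem => //.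
apply: nat_supremums_neq0.
have mu_gt0 k : (j0 A b < k)%N -> 0 < mu k.
  by move=> k1; apply: admissible_weight_gt0; exact: leq_trans k1.
have [k0 k0P] : exists k0, expR 1 <= \sum_((j0 A b).+1 <= j < k0.+1) (a * mu j)^-1.
  apply: contrapT => /forallNP no.
  suff : (\sum_((j0 A b).+1 <= j <oo) ((mu j)^-1)%:E <= (a * expR 1)%:E)%E.
    by rewrite quasianalytic_tail// leNgt ltry.
  apply: lime_le.
    by apply: is_cvg_nneseries => k k1 _; rewrite lee_fin invr_ge0 ltW// mu_gt0.
  apply: nearW => k; rewrite sumEFin lee_fin.
  have /negP := no k; rewrite -ltNge => /ltW.
  under eq_bigr do rewrite invfM.
  rewrite -mulr_sumr ler_pdivrMl//; apply: le_trans.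
  have [kj|jk] := leqP k (j0 A b).+1.
    rewrite [leLHS]big_geq// [leRHS]big_nat; apply: sumr_ge0 => l /andP[l1 _].
    by rewrite invr_ge0 ltW// mu_gt0.
  by rewrite big_nat_recr ?(ltnW jk)//= lerDl invr_ge0 ltW// mu_gt0// ltnW.
exists k0 => k; rewrite /S/= => kS; rewrite leEnat leqNgt; apply/negP => k0k.
move: kS; rewrite ltNge => /negP; apply; apply: le_trans k0P _.
have [k0j|jk0] := leqP k0.+1 (j0 A b).+1.
  rewrite [leLHS]big_geq// [leRHS]big_nat; apply: sumr_ge0 => l /andP[l1 _].
  by rewrite invr_ge0 ltW// mulr_gt0// mu_gt0.
have k0k1 : (k0.+1 <= k.+1)%N := ltnW k0k.
rewrite [leRHS](big_cat_nat (ltnW jk0) k0k1)/= lerDl big_nat; apply: sumr_ge0 => l /andP[l1 _].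
by rewrite invr_ge0 ltW// mulr_gt0// mu_gt0// (leq_trans _ l1)// ltnW.
Qed.

End Degree.

Section Euclidean.
Context {R : realType} {n : nat}.
Implicit Types (x y : 'rV[R]_n) (A B : set 'rV[R]_n).

Lemma coord_le_enorm x i : `|x 0 i| <= enorm x.
Proof.
rewrite -sqrtr_sqr ler_wsqrtr// (bigD1 i)//= lerDl.
by apply: sumr_ge0 => j _; exact: sqr_ge0.
Qed.

Lemma enorm_le (r : R) x : 0 <= r -> (forall i, `|x 0 i| <= r) -> enorm x <= n%:R * r.
Proof.
move=> r0 xr; have nr0 : 0 <= n%:R * r by rewrite mulr_ge0.
rewrite -[leRHS]ger0_norm// -sqrtr_sqr ler_wsqrtr//.
apply: (@le_trans _ _ (\sum_(i < n) r ^+ 2)).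
  by apply: ler_sum => i _; rewrite -real_normK ?num_real// lerXn2r ?nnegrE.
rewrite sumr_const card_ord -[leLHS]mulr_natl exprMn ler_wpM2r ?sqr_ge0//.
by rewrite -natrX ler_nat; case: (n) => // k; rewrite -mulnn leq_pmulr.
Qed.

Lemma diam_le A x (r : R) : 0 <= r ->
  A `<=` box (x - const_mx r) (x + const_mx r) -> diam A <= n%:R * (2 * r).
Proof.
move=> r0 Ax; have r20 : 0 <= 2 * r by rewrite mulr_ge0.
rewrite /diam; set D := [set _ | _ in _].
have [D0|/nonemptyPn ->] := pselect (D !=set0); last by rewrite sup0 mulr_ge0.
apply: ge_sup => // _ [[u v] [/= /Ax Au /Ax Av] <-].
apply: enorm_le => // i; rewrite !mxE.
have := Au i; have := Av i; rewrite !mxE => /andP[? ?] /andP[? ?].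
by rewrite ler_norml; apply/andP; split; lra.
Qed.

Lemma diam_gt0 A : (0 < n)%N -> compact A -> (0 < leb A)%E -> 0 < diam A.
Proof.
move=> n0 cA A0.
have [x [y [Ax Ay xy]]] : exists x y, [/\ A x, A y & x != y].
  apply: contrapT => no.
  suff [x Axx] : exists x, A `<=` box x x.
    have := leb_le_box n0 (fun i => lexx (x 0 i)) Axx.
    by rewrite (bigD1 (Ordinal n0))//= subrr mul0r leNgt A0.
  have [[x Ax]|nA] := pselect (A !=set0); last first.
    by exists 0 => x Ax; exfalso; apply: nA; exists x.
  exists x => y Ay i; suff -> : y = x by rewrite lexx.
  by apply/eqP; apply: contrapT => /negP yx; apply: no; exists y, x.
have [i xyi] : exists i, x 0 i != y 0 i.
  apply: contrapT => /forallNP no; move/eqP: xy; apply; apply/rowP => i.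
  by apply/eqP; apply: contrapT => /negP; exact: no.
apply: (@lt_le_trans _ _ (enorm (x - y))).
  apply: lt_le_trans (coord_le_enorm _ i).
  by rewrite normr_gt0 !mxE subr_eq0.
have [M AM] : has_ubound [set \sum_i `|z 0 i| | z in A].
  apply: (@supnorm_has_ub _ _ _ (fun i z => z 0 i) A A) => // j z _.
  exact: coord_continuous.
apply: ub_le_sup; last by exists (x, y).
exists (n%:R * (M + M)) => _ [[u v] [/= Au Av] <-].
have coordM z j : A z -> `|z 0 j| <= M.
  move=> Az; apply: le_trans (AM _ (imageP _ Az)).
  by rewrite (bigD1 j)//= lerDl sumr_ge0.
apply: enorm_le.
  by rewrite addr_ge0// (le_trans _ (coordM x i Ax)).
move=> j; rewrite !mxE; apply: le_trans (ler_normB _ _) _.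
by apply: lerD; exact: coordM.
Qed.

End Euclidean.

Section LocalGrowth.
Context {R : realType} {n : nat}.
Implicit Types (f g : 'rV[R]_n -> R) (x y : 'rV[R]_n) (K L O E : set 'rV[R]_n).

Definition cube x (r : R) : set 'rV[R]_n := box (x - const_mx r) (x + const_mx r).

Lemma cubeP x (r : R) y : cube x r y <-> forall i, `|y 0 i - x 0 i| <= r.
Proof. by split=> H i; have := H i; rewrite !mxE ler_distl. Qed.

Lemma nbhs_cube x (r : R) : 0 < r -> nbhs x (cube x r).
Proof.
move=> r0; apply/nbhs_ballP; exists r => // y [_ xy]; apply/cubeP => i.
by rewrite distrC; apply/ltW; exact: (xy 0 i).
Qed.

Lemma eball_sub_cube x (r : R) : eball x r `<=` cube x r.
Proof.
move=> y /ltW yx; apply/cubeP => i; apply: le_trans yx.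
by have := coord_le_enorm (y - x) i; rewrite !mxE.
Qed.

Lemma mean_value_cube g O L x y (r : R) : convex_body L -> open O -> L `<=` O ->
  class_C None O g -> 0 <= r -> L x -> L y -> cube x r y ->
  `|g y - g x| <= supnorm (grad g) (L `&` cube x r) * r.
Proof.
move=> [cL convL _] oO LO gO r0 Lx Ly /cubeP yx.
apply: (@mean_value_ineq _ _ g O) => // t t01.
have Lt : L (x + t *: (y - x)) by exact: convex_segment.
split; first exact: LO.
apply: (le_supnorm cL (@subIsetl _ _ _)).
  by move=> i z /LO Oz; exact: gO.1 [:: i] z erefl Oz.
split=> //; apply/cubeP => i; rewrite !mxE addrAC subrr add0r normrM.
have /andP[t0 t1] := t01; rewrite ger0_norm//.
by apply: le_trans (yx i); rewrite ler_piMl.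
Qed.

Lemma supnorm_grad_ge0 g O L E x : compact L -> L `<=` O -> class_C None O g ->
  E `<=` L -> E x -> 0 <= supnorm (grad g) E.
Proof.
move=> cL LO gO EL Ex; apply: (@le_trans _ _ (\sum_i `|grad g i x|)).
  by rewrite sumr_ge0.
apply: (le_supnorm cL EL) => //.
by move=> i z /LO Oz; exact: gO.1 [:: i] z erefl Oz.
Qed.

Lemma supnorm_grad_mono g O L E x : compact L -> L `<=` O -> class_C None O g ->
  E `<=` L -> E x -> supnorm (grad g) E <= supnorm (grad g) L.
Proof.
move=> cL LO gO EL Ex; apply: supnorm_le; first by exists x.
move=> y Ey; apply: (le_supnorm cL (@subset_refl _ _)); last exact: EL.
by move=> i z /LO Oz; exact: gO.1 [:: i] z erefl Oz.
Qed.

Lemma compact_leb_fin K : (0 < n)%N -> compact K -> leb K \is a fin_num.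
Proof.
move=> n0 cK; rewrite ge0_fin_numE ?leb_ge0//.
have [M KM] : has_ubound [set \sum_i `|z 0 i| | z in K].
  apply: (@supnorm_has_ub _ _ _ (fun i z => z 0 i) K K) => // j z _.
  exact: coord_continuous.
have KM' : K `<=` cube 0 `|M|.
  move=> z Kz; apply/cubeP => i; rewrite mxE subr0.
  apply: le_trans (le_trans (KM _ (imageP _ Kz)) (ler_norm _)).
  by rewrite (bigD1 i)//= lerDl sumr_ge0.
apply: le_lt_trans (leb_le_box n0 _ KM') (ltry _) => i.
by rewrite !mxE sub0r add0r (@le_trans _ _ 0)// oppr_le0.
Qed.

Lemma thick_leb_gt0 K (c theta : R) : thick c theta K -> (0 < leb K)%E.
Proof.
move=> [c0 _ [x Kx] _ thickK].
apply: (@lt_le_trans _ _ (leb (K `&` eball x 1))); last first.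
  by apply: le_leb; exact: subIsetl.
apply: lt_le_trans (thickK x 1 Kx _); last by rewrite ltr01 lexx.
by rewrite lte_fin mulr_gt0// powR_gt0.
Qed.

Lemma thick_vol_gt0 K (c theta : R) : (0 < n)%N -> compact K ->
  thick c theta K -> 0 < vol K.
Proof.
move=> n0 cK K_thick; rewrite -lte_fin fineK ?compact_leb_fin//.
exact: thick_leb_gt0 K_thick.
Qed.

Lemma remez_local_growth f K (c theta nu C : R) (N : nat) x (r S : R) :
  (0 < n)%N -> compact K -> thick c theta K -> 0 < nu <= 1 -> 0 < C ->
  (forall E, E `<=` K -> leb_measurable E -> (0 < leb E)%E ->
     supnorm (fun _ : 'I_1 => f) K <=
     C * (1%:R * vol K `^ nu / (vol K `^ nu - (vol K - vol E) `^ nu)) ^+ N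
       * supnorm (fun _ : 'I_1 => f) E) ->
  K x -> 0 < r <= 1 -> (forall y, K y -> cube x r y -> `|f y| <= S) ->
  supnorm (fun _ : 'I_1 => f) K / C * (c * nu / vol K) ^+ N
    * r `^ (theta * N%:R) <= S.
Proof.
move=> n0 cK K_thick nu01 C0 remez Kx r01 fS.
have [c0 theta0 K0 mK thickK] := K_thick; have /andP[r0 r1] := r01; have /andP[nu0 nu1] := nu01.
pose E := K `&` cube x r.
have finK := compact_leb_fin n0 cK.
have EK : E `<=` K by exact: subIsetl.
have finE : leb E \is a fin_num.
  by rewrite ge0_fin_numE ?leb_ge0//; by apply: le_lt_trans (le_leb EK) _; rewrite ltey_eq finK.
have rt0 : 0 < r `^ theta by rewrite powR_gt0.
have crE : c * r `^ theta <= vol E.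
  rewrite -lee_fin fineK//; apply: le_trans (thickK x r Kx r01) _.
  by apply: le_leb; apply: setIS; exact: eball_sub_cube.
have cr0 : 0 < c * r `^ theta by rewrite mulr_gt0.
have E0 : 0 < vol E by exact: lt_le_trans crE.
have EVK : vol E <= vol K by apply: fine_le => //; exact: le_leb.
have V0 : 0 < vol K by exact: thick_vol_gt0 K_thick.
have Ex : E x by split=> //; apply/cubeP => i; rewrite subrr normr0 ltW.
have S0 : 0 <= S by apply: le_trans (fS x Kx Ex.2).
have mE : leb_measurable E by apply: leb_measurableI => //; exact: leb_measurable_box.
have leE0 : (0 < leb E)%E by rewrite -(fineK finE) lte_fin.
have supE : supnorm (fun _ : 'I_1 => f) E <= S.
  by apply: supnorm_le; [exists x|move=> y [Ky xy]; rewrite big_ord1 fS].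
have remezE := remez E EK mE leE0; move: remezE; rewrite mul1r.
have /andP[ratio0 ratioE] : 0 <= vol K `^ nu / (vol K `^ nu - (vol K - vol E) `^ nu)
    <= vol K / (nu * vol E) by apply: remez_ratio_le => //; rewrite E0.
set ratio := _ / _ in ratio0 ratioE * => remezE.
set P := c * nu / vol K * r `^ theta.
have P0 : 0 < P by rewrite mulr_gt0// divr_gt0// mulr_gt0.
have ratioP : ratio <= P^-1.
  apply: le_trans ratioE _.
  have -> : P^-1 = vol K / (nu * (c * r `^ theta)).
    by rewrite /P; field; rewrite !gt_eqF.
  by rewrite ler_pM2l// lef_pV2 ?posrE ?mulr_gt0// ler_pM2l.
rewrite powRrM powR_mulrn ?(ltW rt0)// -mulrA -exprMn -/P.
rewrite -ler_pdivlMr ?exprn_gt0// ler_pdivrMr// -exprVn.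
apply: le_trans remezE _.
have Cratio0 : 0 <= C * ratio ^+ N by rewrite mulr_ge0 ?exprn_ge0// ltW.
apply: le_trans (ler_wpM2l Cratio0 supE) _.
rewrite [leLHS]mulrC -[leRHS]mulrA ler_wpM2l// mulrC ler_wpM2r ?(ltW C0)//.
by rewrite lerXn2r// nnegrE// invr_ge0 ltW.
Qed.

End LocalGrowth.

Theorem corollary1p13 (R : realType) (n : nat) (n_gt0 : (0 < n)%N)
  (mut : (nat -> R) -> R -> R)
  (mut_interp : forall lam : nat -> R,
     admissible_weight lam -> interpolant lam (mut lam))
  (mu : nat -> R)
  (mu_adm : admissible_weight mu) (mu_qa : quasianalytic mu)
  (mu_ge : forall j, (1 <= j)%N -> j%:R <= mu j)
  (mu_reg : regular_weight mu)
  (M0 b0 : R) (M0_ge1 : 1 <= M0) (b0_gt0 : 0 < b0) (b0_lt : b0 < M0)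
  (L K : set 'rV[R]_n) (L_body : convex_body L)
  (d : nat) (K_adm : admissible_set d K) (K_d1 : convex_body K -> d = 1%N)
  (nuK : R) (nuK_remez : remez_constant mut d K nuK)
  (K_sub : K `<=` L°)
  (cK thetaK : R) (K_thick : thick cK thetaK K)
  (f : 'rV[R]_n -> R)
  (f_smooth : smooth mu None M0 L (fun _ : 'I_1 => f))
  (f_ge : b0 <= supnorm (fun _ : 'I_1 => f) K)
  (f_crit : forall x, K x -> (forall i, grad f i x = 0) -> f x = 0) :
  let N := degreeN mu M0 (aK d K) b0 in
  let Z := K `&` [set x | f x = 0] in
  exists (U : set 'rV[R]_n) (B : 'rV[R]_n -> set 'rV[R]_n),
    [/\ U `<=` K /\ (forall z, Z z -> within K (nbhs z) U),
        forall x, U x -> B x `<=` L /\ within L (nbhs x) (B x),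
        forall x, U x ->
          2^-1
          * (2 * supnorm (fun _ : 'I_1 => f) K / (3 * CN (mut mu) N))
              `^ (thetaK * N%:R)^-1
          * (cK * nuK / vol K) `^ thetaK^-1
          * `|f x| `^ (1 - (thetaK * N%:R)^-1)
          <= supnorm (grad f) (B x) &
        forall eps : R, 0 < eps -> exists2 delta : R, 0 < delta &
          forall x, U x -> ~ Z x ->
            (exists2 z, Z z & enorm (x - z) < delta) -> diam (B x) < eps].

  (* your proof *)
Proof.
move=> N Z.
have [W [oW LW fW]] := f_smooth.1; have {}fW := fW ord0.
have [cL convL _] := L_body; have [cK_ _ _] := K_adm.
have KL : K `<=` L by move=> x /K_sub; exact: interior_subset.
have [nu01 _ remez] := nuK_remez; have /andP[nu0 nu1] := nu01.
have [c0 theta0 [x0 Kx0] mK thickK] := K_thick.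
have a0 : 0 < aK d K.
  rewrite /aK; case: ifP => d2.
    rewrite mulr_gt0 ?lt_max ?ltr01 ?orbT// mulr_gt0//.
    by rewrite divr_gt0 ?exprn_gt0// ltr0n; case: (d) d2 => [|[]].
  by apply: diam_gt0 => //; exact: thick_leb_gt0 K_thick.
have N0 : (0 < N)%N by apply: degreeN_gt0 => //; rewrite b0_gt0.
set F := supnorm _ K; have F0 : 0 < F by exact: lt_le_trans f_ge.
set C := CN (mut mu) N; have C0 : 0 < C by rewrite exprn_gt0// mulr_gt0// expR_gt0.
set w := cK * nuK / vol K.
have remezK E : E `<=` K -> leb_measurable E -> (0 < leb E)%E ->
    F <= C * (1%:R * vol K `^ nuK / (vol K `^ nuK - (vol K - vol E) `^ nuK)) ^+ N
      * supnorm (fun _ : 'I_1 => f) E.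
  have := remez L mu M0 b0 1%N L_body KL mu_adm mu_ge b0_gt0 b0_lt isT.
  rewrite mul1r; apply => //; first exact: quasianalytic_admissible.
  split; first by exists W; split=> // _; split=> ? *; [apply: fW.1|apply: fW.2].
  by move=> j _ x Lx; exact: f_smooth.2.
set T := thetaK * N%:R; have T0 : 0 < T by rewrite mulr_gt0// ltr0n.
set kappa := F / C * w ^+ N.
have growth x r S : K x -> 0 < r <= 1 ->
    (forall y, K y -> cube x r y -> `|f y| <= S) -> kappa * r `^ T <= S.
  exact: remez_local_growth.
have w0 : 0 < w by rewrite /w divr_gt0 ?mulr_gt0//; exact: thick_vol_gt0 K_thick.
have kappa0 : 0 < kappa by apply: mulr_gt0; [exact: divr_gt0|exact: exprn_gt0].
pose rad x := (3 / 2 * `|f x| / kappa) `^ T^-1.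
pose U := K `&` [set x | `|f x| < 2 / 3 * kappa].
pose B x := if f x == 0 then L else L `&` cube x (rad x).
have f32_ge0 x : 0 <= 3 / 2 * `|f x| by rewrite mulr_ge0// divr_ge0.
have f32k_ge0 x : 0 <= 3 / 2 * `|f x| / kappa by rewrite divr_ge0// ltW.
have radK x : kappa * rad x `^ T = 3 / 2 * `|f x|.
  by rewrite /rad -powRrM mulVf ?gt_eqF// powRr1// mulrC divfK// gt_eqF.
have rad_le x (r : R) : 0 <= r -> 3 / 2 * `|f x| <= kappa * r `^ T -> rad x <= r.
  move=> r0 le_r; rewrite -[leRHS]powRr1// -(@divff _ T) ?gt_eqF// powRrM.
  apply: ge0_ler_powR.
  - by rewrite invr_ge0 ltW.
  - by rewrite nnegrE.
  - by rewrite nnegrE powR_ge0.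
  - by rewrite ler_pdivrMr// [leRHS]mulrC.
have BL x : B x `<=` L by rewrite /B; case: ifP => _; [exact: subset_refl|exact: subIsetl].
have Bx x : L x -> B x x.
  move=> Lx; rewrite /B; case: ifP => // _; split=> //; apply/cubeP => i.
  by rewrite subrr normr0 powR_ge0.
exists U, B; split.
- split; first exact: subIsetl.
  move=> z [Kz fz0]; have fC := fW.1 [::] z erefl (LW _ (KL _ Kz)).
  have /cvgrPdist_lt/(_ (2 / 3 * kappa)) := fC.
  rewrite /partials/= fz0 mulr_gt0// => /(_ isT); apply: filterS => y.
  by rewrite /= sub0r normrN => ? Ky; split.
- move=> x [Kx fx]; split; first exact: BL.
  rewrite /B; case: ifPn => [_|fx0]; first exact: nearW.
  have rad0 : 0 < rad x by rewrite powR_gt0// divr_gt0// mulr_gt0// normr_gt0.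
  by apply: filterS (nbhs_cube x rad0) => y ? Ly; split.
- move=> x [Kx fx]; have Lx := KL x Kx.
  have G0 := supnorm_grad_ge0 cL LW fW (BL x) (Bx x Lx).
  rewrite /B in G0 *; case: ifPn G0 => [/eqP fx0|fx0] G0.
    rewrite fx0 normr0; have [p1|p1] := eqVneq T^-1 1; last first.
      by rewrite powR0 ?mulr0// subr_eq0 eq_sym.
    have T1 : T = 1 by rewrite -(invrK T) p1 invr1.
    have -> : thetaK^-1 = N%:R by apply: (mulfI (lt0r_neq0 theta0)); rewrite mulfV ?lt0r_neq0.
    rewrite p1 subrr powRr0 mulr1 powRr1; last by rewrite divr_ge0 ?mulr_ge0// ltW.
    rewrite powR_mulrn ?(ltW w0)//.
    apply: (@le_trans _ _ kappa).
      rewrite /kappa (_ : 2^-1 * _ = 3^-1 * (F / C)); last by field; rewrite gt_eqF.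
      rewrite -mulrA ler_piMl ?(ltW kappa0)// invf_le1//.
      by rewrite ler1n.
    have := growth x 1 (supnorm (grad f) L) Kx; rewrite ltr01 lexx powR1 mulr1.
    apply => // y Ky xy.
    have := mean_value_cube L_body oW LW fW ler01 Lx (KL _ Ky) xy.
    rewrite fx0 subr0 mulr1 => /le_trans; apply.
    apply: (supnorm_grad_mono cL LW fW) => [|]; first exact: subIsetl.
    split; [exact: Lx|by apply/cubeP => i; rewrite subrr normr0].
  have nfx0 : 0 < `|f x| by rewrite normr_gt0.
  have rad0 : 0 < rad x by rewrite powR_gt0// divr_gt0// mulr_gt0// divr_gt0.
  set G := supnorm _ _ in G0 *.
  have rad1 : rad x <= 1.
    apply: rad_le => //; rewrite powR1 mulr1.
    have := fx; rewrite /=; lra.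
  have : kappa * rad x `^ T <= `|f x| + G * rad x.
    apply: (growth x) => //; first by rewrite rad0.
    move=> y Ky xy; rewrite -lerBlDl; apply: le_trans (lerB_dist _ _) _.
    exact: (mean_value_cube L_body oW LW fW (ltW rad0) Lx (KL _ Ky) xy).
  rewrite radK => Gr; have {}Gr : `|f x| / (2 * rad x) <= G.
    rewrite ler_pdivrMr ?mulr_gt0//; lra.
  apply: le_trans Gr; rewrite le_eqVlt; apply/orP; left; apply/eqP.
  have wN : w `^ thetaK^-1 = (w ^+ N) `^ T^-1.
    rewrite -powR_mulrn ?(ltW w0)// -powRrM /T invfM mulrCA mulfV ?mulr1//.
    by rewrite pnatr_eq0 -lt0n.
  rewrite wN powRD ?(gt_eqF nfx0) ?implybT// powRr1// powRN.
  set q := 2 * F / (3 * C); have q0 : 0 < q by rewrite divr_gt0 ?mulr_gt0.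
  have wN0 : 0 < w ^+ N by exact: exprn_gt0.
  have qp0 : 0 < q `^ T^-1 by exact: powR_gt0.
  have wp0 : 0 < (w ^+ N) `^ T^-1 by exact: powR_gt0.
  have fp0 : 0 < `|f x| `^ T^-1 by exact: powR_gt0.
  have -> : rad x = `|f x| `^ T^-1 / (q `^ T^-1 * (w ^+ N) `^ T^-1).
    apply: (canRL (mulfK _)); first by rewrite mulf_neq0 ?lt0r_neq0.
    rewrite -(powRM _ (ltW q0) (ltW wN0)) /rad -powRM ?f32k_ge0 ?(mulr_ge0 (ltW q0) (ltW wN0))//.
    congr (_ `^ _); rewrite /kappa /q.
    have cancel (t F1 C1 W1 : R) : 0 < F1 -> 0 < C1 -> 0 < W1 ->
        3 / 2 * t / (F1 / C1 * W1) * (2 * F1 / (3 * C1) * W1) = t.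
      by move=> *; field; rewrite !lt0r_neq0.
    exact: cancel.
  move: (q `^ _) ((w ^+ N) `^ _) (`|f x| `^ _) qp0 wp0 fp0 => *.
  by field; rewrite !lt0r_neq0.
move=> eps eps0; have n_gt0R : 0 < n%:R :> R by rewrite ltr0n.
pose G := supnorm (grad f) L + 1.
have G0 : 0 < G by rewrite ltr_wpDl// (supnorm_grad_ge0 cL LW fW (@subset_refl _ _) (KL _ Kx0)).
pose eta := eps / (4 * n%:R); have eta0 : 0 < eta by rewrite divr_gt0// mulr_gt0.
have etaT0 : 0 < 2 / 3 * kappa * eta `^ T.
  by rewrite mulr_gt0 ?powR_gt0// mulr_gt0// divr_gt0.
exists (2 / 3 * kappa * eta `^ T / G); first by rewrite divr_gt0.
move=> x [Kx fx] nZx [z [Kz fz0] xz]; set delta := (_ / G) in xz.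
have fx0 : f x != 0 by apply/negP => /eqP ?; apply: nZx; split.
have delta0 : 0 < delta by rewrite divr_gt0.
have xz_cube : cube z delta x by apply: eball_sub_cube; rewrite /eball/=.
have fx_le : `|f x| <= G * delta.
  have := mean_value_cube L_body oW LW fW (ltW delta0) (KL _ Kz) (KL _ Kx) xz_cube.
  rewrite fz0 subr0 => /le_trans; apply; rewrite ler_wpM2r ?(ltW delta0)//.
  apply: (@le_trans _ _ (supnorm (grad f) L)); last by rewrite lerDl.
  apply: (supnorm_grad_mono cL LW fW) => [|]; first exact: subIsetl.
  by split; [exact: KL Kz|apply/cubeP => i; rewrite subrr normr0 ltW].
have rad_eta : rad x <= eta.
  apply: rad_le; first exact: ltW.
  have GdE : G * delta = 2 / 3 * kappa * eta `^ T by rewrite /delta mulrC divfK// gt_eqF.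
  rewrite GdE in fx_le; lra.
apply: (@le_lt_trans _ _ (n%:R * (2 * rad x))).
  apply: (@diam_le _ _ _ x); first by rewrite powR_ge0.
  by rewrite /B (negbTE fx0); exact: subIsetr.
apply: (@le_lt_trans _ _ (n%:R * (2 * eta))); first by rewrite !ler_wpM2l// ltW.
rewrite (_ : _ * _ = eps / 2); last by rewrite /eta; field; rewrite gt_eqF.
by rewrite ltr_pdivrMr// mulr_natr mulr2n ltrDl.
Qed.
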